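(* Let $G$ be an amenable discrete group. Then $G$ satisfies Ozawa's Property $O$: for every finite subset $E\subset G$ and every $\epsilon>0$ there exist a finite subset $F\subset G$ and a function $u\colon G\times G\to\mathbb{R}$ (an Ozawa kernel) such that (1) $u$ is a positive definite kernel; (2) for all $x,y\in G$, $u(x,y)\neq 0$ only if $x^{-1}y\in F$; (3) for all $x,y\in G$, $|1-u(x,y)|<\epsilon$ if $x^{-1}y\in E$.
   Context: Amenability is understood via F\o lner's condition: $G$ is amenable if there is a F\o lner sequence, i.e. a sequence $(G_n)_{n\in\mathbb{N}}$ of finite nonempty subsets of $G$ such that for every $g\in G$, $\lim_{n\to\infty}\frac{|gG_n\,\triangle\, G_n|}{|G_n|}=0$. A function $u\colon G\times G\to\mathbb{R}$ is a positive definite kernel if it is symmetric and $\sum_{i,j=1}^{k}\lambda_i\lambda_j u(x_i,x_j)\ge 0$ for all $k\in\mathbb{N}$, all $x_1,\dots,x_k\in G$ and all $\lambda_1,\dots,\lambda_k\in\mathbb{R}$. *)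

(* Defs.v *)
From HB Require Import structures.
From mathcomp Require Import all_boot all_order all_algebra finmap.
From mathcomp Require Import all_classical all_reals all_analysis.
Import Order.TTheory GRing.Theory Num.Theory numFieldNormedType.Exports.
Set Implicit Arguments.
Unset Strict Implicit.
Unset Printing Implicit Defensive.
Local Open Scope classical_set_scope.
Local Open Scope ring_scope.

Definition fsymdiff (T : choiceType) (A B : {fset T}) : {fset T} :=
  ((A `\` B) `|` (B `\` A))%fset.

Definition left_translate (G : groupType) (g : G) (A : {fset G}) : {fset G} :=
  [fset (g * x)%g | x in A]%fset.

Definition folner_sequence (R : realType) (G : groupType)
    (S : nat -> {fset G}) : Prop :=
  (forall n, S n <> fset0) /\
  (forall g : G,
    (fun n => #|` fsymdiff (left_translate g (S n)) (S n)|%:R / #|` S n|%:R : R)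
      @ \oo --> (0 : R)).

Definition amenable (R : realType) (G : groupType) : Prop :=
  exists S : nat -> {fset G}, folner_sequence R S.

Definition positive_definite_kernel (R : realType) (T : Type)
    (u : T -> T -> R) : Prop :=
  (forall x y, u x y = u y x) /\
  (forall (k : nat) (x : 'I_k -> T) (l : 'I_k -> R),
    0 <= \sum_(i < k) \sum_(j < k) l i * l j * u (x i) (x j)).

Definition ozawa_kernel (R : realType) (G : groupType) (E : {fset G}) (eps : R)
    (F : {fset G}) (u : G -> G -> R) : Prop :=
  [/\ positive_definite_kernel u,
      forall x y : G, u x y <> 0 -> (x^-1 * y)%g \in F
    & forall x y : G, (x^-1 * y)%g \in E -> `|1 - u x y| < eps].

Definition property_O (R : realType) (G : groupType) : Prop :=
  forall (E : {fset G}) (eps : R), 0 < eps ->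
    exists (F : {fset G}) (u : G -> G -> R), ozawa_kernel E eps F u.

(* Main.v *)
(** For a finite set [S], the kernel [u x y = |xS `&` yS| / |S|] is a Gram matrix of
    indicator functions, is supported where [x^-1 y] lies in [S S^-1], and satisfies
    [1 - u x y = |S `\` gS| / |S|] with [g = x^-1 y], which is small for all [g] in
    [E] simultaneously once [S] is a sufficiently late Følner set. *)
Require Import Defs.
From mathcomp Require Import all_boot all_order all_algebra finmap.
From mathcomp Require Import all_classical all_reals all_analysis.
Import Order.TTheory GRing.Theory Num.Theory numFieldNormedType.Exports.
Set Implicit Arguments.
Unset Strict Implicit.
Unset Printing Implicit Defensive.
Local Open Scope classical_set_scope.
Local Open Scope ring_scope.

(** The ambient set [U] lets cardinalities of different sets be summed over one common index range,
    so that sums can be exchanged later. *)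
Lemma natr_cardfs_sum_indicator (R : nzSemiRingType) (K : choiceType) (A U : {fset K}) :
  (A `<=` U)%fset -> #|` A|%:R = \sum_(z <- U) (z \in A)%:R :> R.
Proof.
move=> AU; rewrite -natr_sum; congr (_%:R).
rewrite -(big_fset_incl _ AU) => [|z _ /negbTE -> //].
by rewrite -sum1_size; apply: eq_big_seq => z ->.
Qed.

(** Counting each intersection pointwise over the union [U] of the finitely many sets involved turns
    the quadratic form into a sum of squares, one for each [z] in [U]. *)
Lemma cardfsI_positive_definite (R : realType) (T : Type) (K : choiceType)
    (A : T -> {fset K}) :
  positive_definite_kernel (fun x y => #|` A x `&` A y|%fset%:R : R).
Proof.
split=> [x y|k x l]; first by rewrite fsetIC.
pose U := (\bigcup_(i <- enum 'I_k) A (x i))%fset.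
have AU i : (A (x i) `<=` U)%fset by apply: (bigfcup_sup (P := xpredT)); rewrite ?mem_enum.
suff -> : \sum_(i < k) \sum_(j < k) l i * l j * #|` A (x i) `&` A (x j)|%fset%:R
    = \sum_(z <- U) (\sum_(i < k) l i * (z \in A (x i))%:R) ^+ 2 :> R.
  by apply: sumr_ge0 => z _; exact: sqr_ge0.
under [RHS]eq_bigr do rewrite expr2 mulr_suml.
rewrite [RHS]exchange_big /=; apply: eq_bigr => i _.
under [RHS]eq_bigr do rewrite mulr_sumr.
rewrite [RHS]exchange_big /=; apply: eq_bigr => j _.
rewrite (natr_cardfs_sum_indicator R (U := U)); last first.
  by apply: fsubset_trans (AU i); exact: fsubsetIl.
rewrite mulr_sumr; apply: eq_bigr => z _.
(* The indicator of an intersection is the product of the indicators. *)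
by rewrite inE -mulnb natrM mulrACA.
Qed.

Lemma positive_definite_kernelZ (R : realType) (T : Type) (c : R) (u : T -> T -> R) :
  0 <= c -> positive_definite_kernel u ->
  positive_definite_kernel (fun x y => u x y * c).
Proof.
move=> c0 [uC u0]; split=> [x y|k x l]; first by rewrite uC.
under eq_bigr do under eq_bigr do rewrite mulrA.
under eq_bigr do rewrite -mulr_suml.
by rewrite -mulr_suml mulr_ge0.
Qed.

Lemma card_left_translate (G : groupType) (g : G) (A : {fset G}) :
  #|` left_translate g A| = #|` A|.
Proof. by rewrite card_imfset //; exact: mulgI. Qed.

Lemma left_translateM (G : groupType) (g h : G) (A : {fset G}) :
  left_translate (g * h) A = left_translate g (left_translate h A).
Proof.
apply/fsetP => z; apply/imfsetP/imfsetP => /= [[a aA ->]|[_ /imfsetP[a /= aA ->] ->]].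
  by exists (h * a)%g; rewrite ?mulgA// in_imfset.
by exists a; rewrite ?mulgA.
Qed.

Lemma left_translateI (G : groupType) (g : G) (A B : {fset G}) :
  left_translate g (A `&` B)%fset = (left_translate g A `&` left_translate g B)%fset.
Proof. by apply: imfsetI => x y _ _; exact: mulgI. Qed.

(** Translating by [x] is injective, hence preserves intersections and cardinalities. This makes the
    kernel depend on [x^-1 * y] alone. *)
Lemma card_left_translateI (G : groupType) (x y : G) (A : {fset G}) :
  #|` left_translate x A `&` left_translate y A|%fset
  = #|` A `&` left_translate (x^-1 * y) A|%fset.
Proof.
rewrite -(card_left_translate x (A `&` _)%fset) left_translateI.
by rewrite -left_translateM mulVKg.
Qed.

(** For each [g] the bound holds eventually; as [E] is finite, the intersection of these eventual
    sets is again eventual, hence nonempty. *)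
Lemma folner_sequence_uniform (R : realType) (G : groupType)
    (S : nat -> {fset G}) (E : {fset G}) (eps : R) :
  folner_sequence R S -> 0 < eps ->
  exists n, forall g, g \in E ->
    #|` fsymdiff (left_translate g (S n)) (S n)|%:R / #|` S n|%:R < eps.
Proof.
move=> [_ Sinv] eps0.
pose P g := [set n | #|` fsymdiff (left_translate g (S n)) (S n)|%:R
                     / #|` S n|%:R < eps].
have [|n nP] := @filter_ex _ \oo _ (\bigcap_(g in [set` E]) P g).
  apply: filter_bigI => g _.
  exact: (cvgr_lt (0 : R) (Sinv g) eps eps0).
by exists n => g gE; exact: nP.
Qed.

Theorem theorem2 (R : realType) (G : groupType) :
  amenable R G -> property_O R G.
Proof.
move=> [S folS] E eps eps0.
have [n nE] := folner_sequence_uniform E folS eps0.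
have Sn0 : S n <> fset0 by case: folS.
move: (S n) Sn0 nE => A A0 AE {S folS n}.
have cA0 : 0 < #|` A|%:R :> R by rewrite ltr0n cardfs_gt0; apply/eqP.
(* If [A] meets its translate by [g], then [z = g * t] with [z] and [t] in [A], so
   [g = z * t^-1]. *)
exists [fset (s * t^-1)%g | s in A, t in A]%fset.
exists (fun x y => #|` left_translate x A `&` left_translate y A|%fset%:R / #|` A|%:R).
split.
- apply: positive_definite_kernelZ; first by rewrite invr_ge0 ltW.
  exact: cardfsI_positive_definite.
- move=> x y; rewrite card_left_translateI => u0.
  have /fset0Pn[z] : (A `&` left_translate (x^-1 * y) A)%fset != fset0.
    by apply/eqP => I0; apply: u0; rewrite I0 cardfs0 mul0r.
  rewrite inE => /andP[zA /imfsetP[t /= tA zt]].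
  by apply/imfset2P; exists z => //; exists t => //; rewrite zt mulgK.
- move=> x y /AE; rewrite card_left_translateI; apply: le_lt_trans.
  set g := (x^-1 * y)%g.
  (* Writing [1] as [|A| / |A|] turns [1 - u x y] into [|A \ gA| / |A|], and [A \ gA] is one half of
     the symmetric difference of [gA] and [A]. *)
  rewrite -{1}(divff (lt0r_neq0 cA0)) -mulrBl -natrB ?fsubset_leq_card ?fsubsetIl//.
  rewrite -cardfsD ger0_norm ?divr_ge0// ler_pM2r ?invr_gt0// ler_nat.
  exact/fsubset_leq_card/fsubsetUr.
Qed.
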